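(* Let $d\ge2$, let $T$ be a rooted $d$-ary tree, and let $G\subset \mathrm{Aut}(T)$ be a group generated by finite automata, i.e. generated by automorphisms $g$ each of which has only finitely many distinct sections. Then the action $(\partial T,G,\mu_{\partial T})$ is locally non-degenerate.
   Context: A rooted $d$-ary tree $T$ has vertex set $V=\bigsqcup_{\ell\ge0}V_\ell$, where $V_\ell$ is the set of words of length $\ell$ in the alphabet $\{0,1,\ldots,d-1\}$ ($V_0$ is the root, the empty word), and the word $s_1\cdots s_{\ell+1}$ is joined by an edge to $s_1\cdots s_\ell$. The boundary $\partial T$ is the Cantor set of infinite sequences $s_1s_2\cdots$ with $s_i\in\{0,\ldots,d-1\}$. For $v\in V_\ell$, $\partial T_v\subset\partial T$ is the clopen set of sequences beginning with $v$. The counting measure $\mu_{\partial T}$ is the Borel probability measure on $\partial T$ with $\mu_{\partial T}(\partial T_v)=d^{-\ell}$ for $v\in V_\ell$. Every $g\in \mathrm{Aut}(T)$ (root-preserving automorphisms) induces a homeomorphism of $\partial T$. For $g\in \mathrm{Aut}(T)$ and $v\in V_\ell$, the section $g|_v\in \mathrm{Aut}(T)$ is defined by $g(vs)=g(v)\,g|_v(s)$ for all sequences $s\in\partial T$ (concatenation of words). An automorphism $g$ is computed by a finite automaton if and only if the set of sections $\{g|_v\mid v\in V_\ell,\ \ell\ge0\}$ is finite. The action of $g\in \mathrm{Aut}(T)$ on $\partial T$ is locally non-degenerate if there exists $0<\alpha_g\le1$ such that for any vertex $v\in V$, if $g$ fixes $v$ and $g|\partial T_v\neq \mathrm{id}$,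 then $\mu_{\partial T}(\{\mathbf w\in\partial T_v\mid g\cdot\mathbf w\ne\mathbf w\})\ge \alpha_g\,\mu_{\partial T}(\partial T_v)$. The action $(\partial T,G,\mu_{\partial T})$ is locally non-degenerate if the action of every $g\in G$ is locally non-degenerate. *)

(* Defs.v *)
From HB Require Import structures.
From mathcomp Require Import all_boot all_order all_algebra.
From mathcomp Require Import all_classical all_reals all_analysis.

Set Implicit Arguments.
Unset Strict Implicit.
Unset Printing Implicit Defensive.

Import Order.TTheory GRing.Theory Num.Theory.
Local Open Scope classical_set_scope.

(* The tree: the vertices of level l are the words of size l. *)

Definition word (d : nat) : Type := seq 'I_d.

Definition tree_edge d (u v : word d) : bool :=
  [exists s, v == rcons u s] || [exists s, u == rcons v s].

(* Root-preserving automorphisms of the d-ary tree. *)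
Record treeAut (d : nat) := TreeAut {
  aut_fun :> word d -> word d;
  aut_bij : bijective aut_fun;
  aut_edge : forall u v, tree_edge (aut_fun u) (aut_fun v) = tree_edge u v;
  aut_root : aut_fun [::] = [::] }.

Section treeAut_theory.
Variable d : nat.
Implicit Types (g h : treeAut d) (u v : word d).

Lemma treeAut_ext g h : g =1 h -> g = h.
Proof.
case: g h => [g gb ge gr] [h hb he hr] /= /funext gh.
case: h / gh hb he hr => hb he hr.
by congr TreeAut; exact: Prop_irrelevance.
Qed.

Lemma aut_inj g : injective g.
Proof. exact: bij_inj (aut_bij g). Qed.

Lemma aut_rcons g u s : size (g u) = size u /\
  exists t, g (rcons u s) = rcons (g u) t.
Proof.
elim/last_ind: u s => [|u r IH] s.
  rewrite aut_root; split=> //.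
  have : tree_edge (g [::]) (g (rcons [::] s)).
    by rewrite aut_edge; apply/orP; left; apply/existsP; exists s.
  rewrite aut_root => /orP[] /existsP[t /eqP E]; first by exists t.
  by have := congr1 size E; rewrite size_rcons.
have [szu [t gt]] := IH r.
split; first by rewrite gt !size_rcons szu.
have : tree_edge (g (rcons u r)) (g (rcons (rcons u r) s)).
  by rewrite aut_edge; apply/orP; left; apply/existsP; exists s.
case/orP => /existsP[t' /eqP E]; first by exists t'.
move: E; rewrite gt => /rcons_inj[/aut_inj/(congr1 size) + _].
by rewrite !size_rcons => /eqP; rewrite ltn_eqF // ltnW.
Qed.

Lemma size_aut g u : size (g u) = size u.
Proof.
elim/last_ind: u => [|u s _]; first by rewrite aut_root.
by have [su [t ->]] := aut_rcons g u s; rewrite !size_rcons su.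
Qed.

Lemma aut_cat g u v : exists v', g (u ++ v) = g u ++ v'.
Proof.
elim/last_ind: v => [|v s [v' IH]]; first by exists [::]; rewrite !cats0.
rewrite -rcons_cat; have [_ [t ->]] := aut_rcons g (u ++ v) s.
by exists (rcons v' t); rewrite IH rcons_cat.
Qed.

Definition aut_one : treeAut d :=
  @TreeAut d id (Bijective (fun=> erefl) (fun=> erefl))
    (fun _ _ => erefl) erefl.

Lemma aut_mul_edge g h u v :
  tree_edge ((g \o h) u) ((g \o h) v) = tree_edge u v.
Proof. by rewrite /= !aut_edge. Qed.

Lemma aut_mul_root g h : (g \o h) [::] = [::].
Proof. by rewrite /= !aut_root. Qed.

Definition aut_mul g h : treeAut d :=
  TreeAut (bij_comp (aut_bij g) (aut_bij h))
    (@aut_mul_edge g h) (aut_mul_root g h).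

Lemma aut_inv_subproof g : exists h : treeAut d, cancel g h /\ cancel h g.
Proof.
have [h gK hK] := aut_bij g.
have he u v : tree_edge (h u) (h v) = tree_edge u v.
  by rewrite -(aut_edge g) !hK.
have hr : h [::] = [::] by rewrite -{1}(aut_root g) gK.
by exists (@TreeAut d h (Bijective hK gK) he hr).
Qed.

Definition aut_inv g : treeAut d := sval (cid (aut_inv_subproof g)).

Lemma aut_invK g : cancel g (aut_inv g).
Proof. by rewrite /aut_inv; case: cid => h []. Qed.

Lemma aut_Kinv g : cancel (aut_inv g) g.
Proof. by rewrite /aut_inv; case: cid => h []. Qed.

End treeAut_theory.

HB.instance Definition _ d := gen_eqMixin (treeAut d).
HB.instance Definition _ d := gen_choiceMixin (treeAut d).

Section treeAut_group.
Variable d : nat.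

Lemma aut_mulA : associative (@aut_mul d).
Proof. by move=> f g h; exact: treeAut_ext. Qed.
Lemma aut_mul1g : left_id (aut_one d) (@aut_mul d).
Proof. by move=> f; apply: treeAut_ext. Qed.
Lemma aut_mulg1 : right_id (aut_one d) (@aut_mul d).
Proof. by move=> f; apply: treeAut_ext. Qed.
Lemma aut_mulVg : left_inverse (aut_one d) (@aut_inv d) (@aut_mul d).
Proof. by move=> f; apply: treeAut_ext => u /=; rewrite aut_invK. Qed.
Lemma aut_mulgV : right_inverse (aut_one d) (@aut_inv d) (@aut_mul d).
Proof. by move=> f; apply: treeAut_ext => u /=; rewrite aut_Kinv. Qed.

(* The product g * h is the composition: (g * h) v = g (h v). *)
HB.instance Definition _ := isGroup.Build (treeAut d)
  aut_mulA aut_mul1g aut_mulg1 aut_mulVg aut_mulgV.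

End treeAut_group.

Definition generated_group d (S : set (treeAut d)) : set (treeAut d) :=
  smallest (fun H : set (treeAut d) => group_closed (mem H)) S.

Section sections.
Variable d : nat.
Implicit Types (g h : treeAut d) (u v : word d).

Definition section_fun g v u : word d := drop (size v) (g (v ++ u)).

Lemma section_funE g v u : g (v ++ u) = g v ++ section_fun g v u.
Proof.
rewrite /section_fun; have [w ->] := aut_cat g v u.
by rewrite -(size_aut g v) drop_size_cat.
Qed.

Lemma section_funK g v :
  cancel (section_fun g v) (section_fun (aut_inv g) (g v)).
Proof.
move=> u; rewrite {1}/section_fun -section_funE aut_invK size_aut.
by rewrite drop_size_cat.
Qed.

Lemma section_bij g v : bijective (section_fun g v).
Proof.
exists (section_fun (aut_inv g) (g v)); first exact: section_funK.
have gi : aut_inv (aut_inv g) = g.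
  by apply: treeAut_ext => u; rewrite -{1}(aut_invK g u) aut_invK.
move=> u; have := section_funK (aut_inv g) (g v) u.
by rewrite gi aut_invK.
Qed.

Lemma tree_edge_cat v u w : tree_edge (v ++ u) (v ++ w) = tree_edge u w.
Proof.
by congr orb; apply/eq_existsb => s; rewrite rcons_cat eqseq_cat // eqxx.
Qed.

Lemma section_edge g v u w :
  tree_edge (section_fun g v u) (section_fun g v w) = tree_edge u w.
Proof.
by rewrite -(tree_edge_cat (g v)) -!section_funE aut_edge tree_edge_cat.
Qed.

Lemma section_root g v : section_fun g v [::] = [::].
Proof.
by rewrite /section_fun cats0 drop_oversize // size_aut.
Qed.

Definition section_at g v : treeAut d :=
  TreeAut (section_bij g v) (section_edge g v) (section_root g v).

Lemma section_atE g v u : g (v ++ u) = g v ++ section_at g v u.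
Proof. exact: section_funE. Qed.

Definition finite_automaton g : Prop := finite_set (range (section_at g)).

End sections.

(* The alphabet carries a proof of 1 < d, which makes it inhabited: measurable
   types are required to be. *)
Definition letter d (hd : (1 < d)%N) : Type := 'I_d.

HB.instance Definition _ d (hd : (1 < d)%N) := Finite.copy (letter hd) 'I_d.
HB.instance Definition _ d (hd : (1 < d)%N) :=
  isPointed.Build (letter hd) (Ordinal (ltnW hd)).

(* Infinite sequences of letters, with the product topology. *)
Definition boundary d (hd : (1 < d)%N) : Type :=
  prod_topology (fun _ : nat => discrete_topology (letter hd)).

HB.instance Definition _ d (hd : (1 < d)%N) := Pointed.on (boundary hd).
HB.instance Definition _ d (hd : (1 < d)%N) := Topological.on (boundary hd).

Definition boundary_borel d (hd : (1 < d)%N) :=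
  g_sigma_algebraType (@open (boundary hd)).

Section boundary.
Variables (d : nat) (hd : (1 < d)%N).
Implicit Types (g : treeAut d) (v : word d) (w : boundary hd).

Definition initial w (n : nat) : word d := mkseq w n.

Definition cylinder v : set (boundary hd) := [set w | initial w (size v) = v].

(* The default value w n of nth is never used, as automorphisms preserve the
   size of words. *)
Definition boundary_act g w : boundary hd :=
  fun n => nth (w n) (g (initial w n.+1)) n.

Lemma size_initial w n : size (initial w n) = n.
Proof. exact: size_mkseq. Qed.

Lemma initialS w n : initial w n.+1 = rcons (initial w n) (w n).
Proof. exact: mkseqS. Qed.

Lemma boundary_actE g w n : initial (boundary_act g w) n = g (initial w n).
Proof.
elim: n => [|n IH]; first by rewrite aut_root.
rewrite initialS IH /boundary_act initialS.
have [sz [t ->]] := aut_rcons g (initial w n) (w n).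
by rewrite nth_rcons sz size_mkseq ltnn eqxx.
Qed.

Definition boundary_cat v w : boundary hd :=
  fun n => nth (w (n - size v)%N) v n.

(* the equation g(vs) = g(v) g|_v(s) that defines sections *)
Lemma section_at_boundary g v w :
  boundary_act g (boundary_cat v w) =
  boundary_cat (g v) (boundary_act (section_at g v) w).
Proof.
have catE u w' m : initial (boundary_cat u w') (size u + m) = u ++ initial w' m.
  rewrite /initial /mkseq iotaD map_cat; congr cat.
    apply: (@eq_from_nth _ (point : letter hd)) => [|i].
      by rewrite size_map size_iota.
    rewrite size_map size_iota => iu.
    by rewrite (nth_map 0%N) ?size_iota// nth_iota//=; exact: set_nth_default.
  rewrite -[X in iota X _]addn0 add0n iotaDl -map_comp; apply: eq_map => i /=.
  by rewrite /boundary_cat nth_default ?leq_addr// addKn.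
have inj (w1 w2 : boundary hd) :
    (forall m, initial w1 (size v + m) = initial w2 (size v + m)) -> w1 = w2.
  move=> E; apply/funext => n; have := congr1 (fun s => nth (point : letter hd) s n) (E n.+1).
  by rewrite !nth_mkseq // addnS ltnS leq_addl.
apply: inj => m.
by rewrite boundary_actE catE -(size_aut g v) catE boundary_actE section_atE.
Qed.

End boundary.

Arguments cylinder {d} hd v.

Section counting_measure.
Variables (R : realType) (d : nat) (hd : (1 < d)%N).
Variable mu : probability (boundary_borel hd) R.

Definition is_counting_measure : Prop :=
  forall v : word d, mu (cylinder hd v) = ((d%:R ^- size v)%R%:E)%E.

Definition locally_nondegenerate (g : treeAut d) : Prop :=
  exists alpha : R, [/\ (0 < alpha)%R, (alpha <= 1)%R &
    forall v : word d, g v = v ->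
      ~ (forall w : boundary hd, cylinder hd v w -> boundary_act g w = w) ->
      (alpha%:E * mu (cylinder hd v) <=
       mu [set w | cylinder hd v w /\ boundary_act g w <> w])%E].

Definition locally_nondegenerate_action (G : set (treeAut d)) : Prop :=
  forall g, G g -> locally_nondegenerate g.

End counting_measure.

(* A counting measure exists: push the Lebesgue measure of [0, 1[ forward along
   the base d expansion. *)
Section counting_measure_exists.
Variables (R : realType) (d : nat) (hd : (1 < d)%N).
Local Open Scope ring_scope.

Lemma cylinder_rcons (v : word d) (s : 'I_d) (w : boundary hd) :
  cylinder hd (rcons v s) w <-> cylinder hd v w /\ w (size v) = s.
Proof.
rewrite /cylinder /= size_rcons initialS; split=> [/rcons_inj[-> ->]//|].
by case=> -> ->.
Qed.

Lemma initial_nth (w : boundary hd) (n i : nat) (x0 : 'I_d) :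
  (i < n)%N -> nth x0 (initial w n) i = w i.
Proof. by move=> in_; rewrite nth_mkseq. Qed.

Lemma nbhs_cylinder (w : boundary hd) (A : set (boundary hd)) :
  nbhs w A -> exists n, cylinder hd (initial w n) `<=` A.
Proof.
pose F := filter_from [set: nat] (fun n => cylinder hd (initial w n)).
have FF : Filter F.
  apply: filter_from_filter; first by exists 0%N.
  move=> i j _ _; exists (maxn i j) => // w'.
  rewrite /cylinder /= !size_initial => E.
  by split; apply/eq_in_map => k; rewrite mem_iota add0n => /andP[_ kij];
    rewrite -(initial_nth w' (n := maxn i j) (w k)) ?E ?initial_nth// leq_max
      kij ?orbT.
suff Fw : F --> w by move=> /Fw[n _ ?]; exists n.
apply/cvg_sup => i B [C [[D oD <-] /= Dw CB]].
exists i.+1 => // w'; rewrite /cylinder [X in X -> _]/mkset size_initial => E; apply: CB => /=.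
suff -> : w' i = w i by [].
by rewrite -(initial_nth w' (n := i.+1) (w i)) ?E ?initial_nth.
Qed.

Definition digits (x : measurableTypeR R) : boundary_borel hd :=
  fun n => Ordinal (ltn_pmod (Num.truncn (x * d%:R ^+ n.+1)) (ltnW hd)).

Lemma measurable_truncn_eq (n m : nat) :
  measurable [set x : measurableTypeR R | Num.truncn (x * d%:R ^+ n) = m].
Proof.
have d0 : (0 : R) < d%:R ^+ n by rewrite exprn_gt0// ltr0n ltnW.
have mle k : measurable
    [set x : measurableTypeR R | (Num.truncn (x * d%:R ^+ n) <= k)%N].
  rewrite (_ : [set _ | _] = [set` `]-oo, k.+1%:R / d%:R ^+ n[ ]) //.
  by apply/seteqP; split => x /=; rewrite in_itv/= truncn_le_nat ltr_pdivlMr.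
case: m => [|m].
  rewrite (_ : [set _ | _] =
    [set x : measurableTypeR R | (Num.truncn (x * d%:R ^+ n) <= 0)%N]) //.
  by apply/seteqP; split=> x /=; [move=> ->|rewrite leqn0 => /eqP].
rewrite (_ : [set _ | _] =
    [set x : measurableTypeR R | (Num.truncn (x * d%:R ^+ n) <= m.+1)%N] `\`
    [set x : measurableTypeR R | (Num.truncn (x * d%:R ^+ n) <= m)%N]).
  exact: measurableD.
apply/seteqP; split=> x /=; first by move=> ->; rewrite ltnn.
by case=> xm /negP; rewrite -ltnNge => mx; apply/eqP; rewrite eqn_leq xm.
Qed.

Lemma measurable_digits_cylinder (v : word d) :
  measurable (digits @^-1` cylinder hd v).
Proof.
elim/last_ind: v => [|v s IH].
  rewrite (_ : _ @^-1` _ = setT); first exact: measurableT.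
  exact/seteqP.
rewrite (_ : _ @^-1` _ = digits @^-1` cylinder hd v `&`
  \bigcup_m [set x : measurableTypeR R | (m %% d)%N = s /\
     Num.truncn (x * d%:R ^+ (size v).+1) = m]).
  apply: measurableI => //; apply: bigcup_measurable => m _.
  have [ms|ms] := eqVneq (m %% d)%N (s : nat).
    rewrite (_ : [set _ | _] = [set x : measurableTypeR R |
      Num.truncn (x * d%:R ^+ (size v).+1) = m]).
      exact: measurable_truncn_eq.
    by apply/seteqP; split=> x //= [].
  rewrite (_ : [set _ | _] = set0) //; apply/seteqP; split=> x //= [ms' _].
  by move/eqP: ms.
apply/seteqP; split=> x /=.
  move=> /cylinder_rcons[? vs]; split=> //.
  exists (Num.truncn (x * d%:R ^+ (size v).+1)) => //; split=> //.
  by rewrite -vs.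
move=> [? [m _ [ms xm]]]; apply/cylinder_rcons; split=> //.
by apply/val_inj; rewrite /= xm.
Qed.

Lemma measurable_digits : measurable_fun [set: measurableTypeR R] digits.
Proof.
have mG := @measurability _ _ (measurableTypeR R) (boundary_borel hd) setT
  digits (@open (boundary hd)) erefl.
apply: mG => _ [U oU <-].
rewrite setTI (_ : _ @^-1` _ = \bigcup_(v : word d)
  [set x | cylinder hd v `<=` U /\ (digits @^-1` cylinder hd v) x]).
  apply: countable_bigcupT_measurable => [|v]; first exact: countableP.
  have [vU|vU] := pselect (cylinder hd v `<=` U).
    rewrite (_ : [set _ | _] = digits @^-1` cylinder hd v).
      exact: measurable_digits_cylinder.
    by apply/seteqP; split => x //= [].
  by rewrite (_ : [set _ | _] = set0) //; apply/seteqP; split=> x //= [].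
apply/seteqP; split=> x /=.
  move=> xU; have [n nU] := nbhs_cylinder (open_nbhs_nbhs (conj oU xU)).
  by exists (initial (digits x) n) => //; split=> //; rewrite /cylinder/= size_initial.
by move=> [v _ [vU /vU]].
Qed.

Let mI : measurable ([set` `[0, 1[ ] : set (measurableTypeR R)).
Proof. exact: measurable_itv. Qed.

Definition digits_measure : set (boundary_borel hd) -> \bar R :=
  pushforward (mrestr (@lebesgue_measure R) mI) digits.

HB.instance Definition _ := Measure.copy digits_measure
  (measure_function_pushforward__canonical__measure_function_Measure
    (mrestr (@lebesgue_measure R) mI) measurable_digits).

Let digits_measureT : digits_measure setT = 1%E.
Proof.
rewrite /digits_measure /pushforward /mrestr preimage_setT setTI.
by rewrite lebesgue_measure_itv /= lte_fin ltr01 sube0.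
Qed.

HB.instance Definition _ :=
  Measure_isProbability.Build _ _ _ digits_measure digits_measureT.

Let value (v : word d) : nat := foldl (fun a (s : 'I_d) => (a * d + s)%N) 0%N v.

Let cylinder_value (x : R) (v : word d) : 0 <= x < 1 ->
  cylinder hd v (digits x) <-> Num.truncn (x * d%:R ^+ size v) = value v.
Proof.
move=> /andP[x0 x1]; elim/last_ind: v => [|v s IH].
  rewrite expr0 mulr1; split=> // _; apply: truncn_def.
  by rewrite x0.
rewrite cylinder_rcons IH size_rcons /value -cats1 foldl_cat /= -/(value v).
set M := Num.truncn (x * d%:R ^+ (size v).+1).
have <- : (M %/ d)%N = Num.truncn (x * d%:R ^+ size v).
  have y0 n : 0 <= x * d%:R ^+ n by rewrite mulr_ge0// exprn_ge0.
  have E k : (k <= M %/ d)%N = (k <= Num.truncn (x * d%:R ^+ size v))%N.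
    rewrite (leq_divRL _ _ (ltnW hd)) (truncn_ge_nat _ (y0 _)).
    rewrite (truncn_ge_nat _ (y0 _)) exprSr mulrA natrM.
    by rewrite ler_pM2r// ltr0n ltnW.
  by apply/eqP; rewrite eqn_leq -E leqnn E leqnn.
split=> [[<- <-]|E]; first by rewrite /= -divn_eq.
rewrite E (divnMDl _ _ (ltnW hd)) (divn_small (ltn_ord s)) addn0; split=> //.
by apply/val_inj; rewrite /= -/M E modnMDl (modn_small (ltn_ord s)).
Qed.

Let value_lt (v : word d) : (value v < d ^ size v)%N.
Proof.
elim/last_ind: v => [|v s IH] //.
rewrite size_rcons /value -cats1 foldl_cat /= -/(value v) expnSr.
by rewrite (leq_trans _ (leq_mul IH (leqnn d)))// mulSn addnC ltn_add2r.
Qed.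

Lemma counting_measure_exists :
  exists mu : probability (boundary_borel hd) R, is_counting_measure mu.
Proof.
exists digits_measure => v.
transitivity (@lebesgue_measure R (digits @^-1` cylinder hd v `&` `[0, 1[)) => //.
have d0 : (0 : R) < d%:R ^+ size v by rewrite exprn_gt0// ltr0n ltnW.
rewrite (_ : _ `&` _ =
  [set` `[(value v)%:R / d%:R ^+ size v, (value v).+1%:R / d%:R ^+ size v[ ]).
  rewrite lebesgue_measure_itv /= lte_fin ltr_pM2r ?invr_gt0// ltr_nat ltnSn.
  by rewrite -EFinD -mulrBl -natr1 addrAC subrr add0r mul1r.
have tE x : 0 <= x -> (Num.truncn (x * d%:R ^+ size v) = value v) <->
   (value v)%:R <= x * d%:R ^+ size v < (value v).+1%:R.
  move=> x0; have y0 : 0 <= x * d%:R ^+ size v by rewrite mulr_ge0// ltW.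
  by rewrite -truncn_eq//; split=> [->|/eqP].
apply/seteqP; split=> x /=; rewrite !in_itv /= ler_pdivrMr// ltr_pdivlMr//.
  by move=> [/cylinder_value + x01] => /(_ x01)/tE; apply; case/andP: x01.
move=> H; case/andP: (H) => H1 H2.
have x0 : 0 <= x by rewrite -(pmulr_lge0 _ d0) (le_trans _ H1).
have x1 : x < 1.
  rewrite -(ltr_pM2r d0) mul1r (lt_le_trans H2)// -natrX ler_nat.
  exact: value_lt.
have x01 : 0 <= x < 1 by rewrite x0.
by split=> //; apply/cylinder_value => //; exact/tE.
Qed.

End counting_measure_exists.

(* Main.v *)
Require Import Defs.
From mathcomp Require Import all_boot all_order all_algebra.
From mathcomp Require Import all_classical all_reals all_analysis.

(** If [g] fixes [v] and moves a point below [v], its section at [v] is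
    nontrivial, so it moves some word [u], and every sequence starting with
    [v ++ u] is moved by [g]; these have measure [d^-|u|] relative to the
    cylinder of [v].  When [g] has finitely many sections, finitely many words
    [u] suffice, and [alpha_g] is the least of these [d^-|u|].  Elements of [G]
    have finitely many sections, because [(gh)|_v = g|_(hv) h|_v] and
    [(g^-1)|_v = (g|_(g^-1 v))^-1]. *)

Import Order.TTheory GRing.Theory Num.Theory.
Local Open Scope classical_set_scope.

Section finite_automata.
Variable d : nat.
Implicit Types (g h : treeAut d) (u v : word d).

Lemma section_atM g h v :
  section_at (aut_mul g h) v = aut_mul (section_at g (h v)) (section_at h v).
Proof.
apply: treeAut_ext => u; rewrite /= /section_fun /= section_atE section_atE.
by rewrite drop_size_cat ?size_aut // -(size_aut h v) drop_size_cat.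
Qed.

Lemma section_atV g v :
  section_at (aut_inv g) v = aut_inv (section_at g (aut_inv g v)).
Proof.
apply: treeAut_ext => u.
(* After applying the section of [g] at [aut_inv g v] to both sides, what remains is [section_funK]
   for [aut_inv g], up to its double inverse. *)
apply: (can_inj (aut_invK (section_at g (aut_inv g v)))).
rewrite aut_Kinv; have := section_funK (aut_inv g) v.
have -> : aut_inv (aut_inv g) = g.
  by apply: treeAut_ext => w; rewrite -{1}(aut_invK g w) aut_invK.
exact.
Qed.

Lemma finite_automaton1 : finite_automaton (aut_one d).
Proof.
apply: (@sub_finite_set _ _ [set aut_one d]); last exact: finite_set1.
move=> _ [v _ <-]; apply: treeAut_ext => u /=.
by rewrite /section_fun /= drop_size_cat.
Qed.

Lemma finite_automatonM g h :
  finite_automaton g -> finite_automaton h -> finite_automaton (aut_mul g h).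
Proof.
move=> fg fh; apply: sub_finite_set (finite_image2 (@aut_mul d) fg fh).
move=> _ [v _ <-]; rewrite section_atM.
by exists (section_at g (h v)); [exists (h v)|exists (section_at h v); [exists v|]].
Qed.

Lemma finite_automatonV g : finite_automaton g -> finite_automaton (aut_inv g).
Proof.
move=> fg; apply: sub_finite_set (finite_image (@aut_inv d) fg).
move=> _ [v _ <-]; rewrite section_atV.
by exists (section_at g (aut_inv g v)); first by exists (aut_inv g v).
Qed.

Lemma finite_automaton_generated (S : set (treeAut d)) :
  S `<=` @finite_automaton d -> generated_group S `<=` @finite_automaton d.
Proof.
(* The automorphisms with finitely many sections form a subgroup: it contains the identity and is
   closed under [g * h^-1]. *)
apply: smallest_sub; split; first by rewrite inE; exact: finite_automaton1.
move=> g h; rewrite !inE => fg fh.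
exact: finite_automatonM fg (finite_automatonV _ fh).
Qed.

(** The bound is uniform in [v] because the moved word is chosen for the section, not for the
    vertex, and only finitely many sections occur. *)
Lemma bounded_moved_words g : finite_automaton g ->
  exists N, forall v, section_at g v <> aut_one d ->
    exists2 u, (size u <= N)%N & section_at g v u <> u.
Proof.
move=> /finite_seqP[s gs].
(* The value of [f] at the identity is arbitrary; it can only enlarge the maximum below. *)
have [f fP] : {f & forall h, h <> aut_one d -> h (f h) <> f h}.
  apply: (@choice _ _ (fun h u => h <> aut_one d -> h u <> u)) => h.
  have [->|h1] := pselect (h = aut_one d); first by exists [::].
  apply: contra_notP h1 => /forallNP hf; apply: treeAut_ext => u.
  by apply: contrapT => hu; apply: (hf u).
exists (\max_(h <- s) size (f h)) => v v1; exists (f (section_at g v)).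
  apply: (@leq_bigmax_seq _ s xpredT (fun h => size (f h))) => //.
  have : range (section_at g) (section_at g v) by exists v.
  by rewrite gs.
exact: fP.
Qed.

End finite_automata.

Section cylinders.
Context {d : nat} (hd : (1 < d)%N).
Implicit Types (g : treeAut d) (u v : word d) (w : boundary hd).

Lemma open_cylinder v : open (cylinder hd v).
Proof.
elim/last_ind: v => [|v s IH].
  by rewrite (_ : cylinder _ _ = setT); [exact: openT|exact/seteqP].
rewrite (_ : cylinder _ _ = cylinder hd v `&`
    @proj nat (fun=> discrete_topology (letter hd)) (size v) @^-1` [set s]).
  apply: openI => //; apply: open_comp; last exact: discrete_open.
  by move=> w _; exact: proj_continuous.
by apply/seteqP; split=> w; rewrite cylinder_rcons.
Qed.

Lemma initial_add w n m : exists u, initial w (n + m) = initial w n ++ u.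
Proof. by rewrite /initial /mkseq iotaD map_cat; eexists. Qed.

Lemma cylinder_catl u v : cylinder hd (v ++ u) `<=` cylinder hd v.
Proof.
move=> w; rewrite /cylinder /= size_cat.
have [u' ->] := initial_add w (size v) (size u) => /eqP.
by rewrite eqseq_cat ?size_initial // => /andP[/eqP].
Qed.

(** Asking only for arbitrarily long common prefixes lets one compare at lengths beyond a given
    vertex. *)
Lemma initial_inj w w' :
  (forall n, exists2 m, (n < m)%N & initial w m = initial w' m) -> w = w'.
Proof.
move=> E; apply/funext => n; have [m nm ww'] := E n.
by rewrite -(initial_nth _ (point : letter hd) nm) ww' initial_nth.
Qed.

Lemma boundary_act_neqP g w :
  boundary_act g w <> w <-> exists n, g (initial w n) <> initial w n.
Proof.
split; last by move=> [n gn] gw; apply: gn; rewrite -boundary_actE gw.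
apply: contra_notP => /forallNP gw; apply: initial_inj => n.
by exists n.+1 => //; rewrite boundary_actE; exact: contrapT.
Qed.

Lemma boundary_act_section1 g v w : g v = v -> section_at g v = aut_one d ->
  cylinder hd v w -> boundary_act g w = w.
Proof.
move=> gv g1 wv; apply: initial_inj => n; exists (size v + n.+1)%N.
  by rewrite addnS ltnS leq_addl.
have [u wu] := initial_add w (size v) n.+1.
by rewrite boundary_actE wu wv section_atE g1 gv.
Qed.

Lemma cylinder_moved g v w :
  g v <> v -> cylinder hd v w -> boundary_act g w <> w.
Proof. by move=> gv wv; apply/boundary_act_neqP; exists (size v); rewrite wv. Qed.

(** A moved sequence has a moved prefix, whose whole cylinder is then moved. Openness gives the
    measurability that monotonicity of [mu] requires. *)
Lemma open_moved g : open [set w : boundary hd | boundary_act g w <> w].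
Proof.
rewrite (_ : [set _ | _] = \bigcup_(v in [set v | g v <> v]) cylinder hd v).
  by apply: bigcup_open => v _; exact: open_cylinder.
apply/seteqP; split=> w /=; last by move=> [v gv]; exact: cylinder_moved.
move=> /boundary_act_neqP[n gn]; exists (initial w n) => //.
by rewrite /cylinder /= size_initial.
Qed.

End cylinders.

Lemma finite_automaton_nondegenerate (R : realType) (d : nat) (hd : (1 < d)%N)
    (mu : probability (boundary_borel hd) R) (hmu : is_counting_measure mu)
    (g : treeAut d) :
  finite_automaton g -> locally_nondegenerate mu g.
Proof.
move=> /bounded_moved_words[N gN].
have d0 : (0 < d%:R :> R)%R by rewrite ltr0n ltnW.
have d1 : (1 <= d%:R :> R)%R by rewrite ler1n ltnW.
(* Since [size u <= N], this is at most the relative measure [d^-|u|] of the cylinder of [v ++ u] in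
   that of [v]. *)
exists (d%:R ^- N)%R; split.
- by rewrite invr_gt0 exprn_gt0.
- by rewrite invf_le1 ?exprn_gt0 // exprn_ege1.
move=> v gv vmoved; have [|u uN gu] := gN v.
  by move=> g1; apply: vmoved => w; exact: boundary_act_section1.
have gvu : g (v ++ u) <> v ++ u.
  by rewrite section_atE gv => /eqP; rewrite eqseq_cat // eqxx => /eqP.
apply: (@le_trans _ _ (mu (cylinder hd (v ++ u)))).
  rewrite !hmu -EFinM lee_fin -invfM -exprD size_cat addnC.
  by rewrite lef_pV2 ?posrE ?exprn_gt0 // ler_weXn2l // leq_add2l.
apply: le_measure; rewrite ?inE.
- by apply: sub_sigma_algebra; exact: open_cylinder.
- apply: sub_sigma_algebra.
  exact: openI (open_cylinder hd v) (open_moved hd g).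
- by move=> w vuw; split; [exact: cylinder_catl vuw|exact: cylinder_moved vuw].
Qed.

Theorem mainTheorem7 (R : realType) (d : nat) (hd : (1 < d)%N)
  (mu : probability (boundary_borel hd) R) (hmu : is_counting_measure mu)
  (G S : set (treeAut d)) (hG : G = generated_group S)
  (hS : forall g : treeAut d, S g -> finite_automaton g) :
  locally_nondegenerate_action mu G.
Proof.
move=> g; rewrite hG => /(finite_automaton_generated _ _ hS).
exact: finite_automaton_nondegenerate.
Qed.
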